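(* Fix any $u\in(0,1/8)$. For any $\sigma>0$, $n\ge2$, $p\ge1$, any integer length $1\le r\le n/4$, and any integer sparsity $1\le s\le p$, $$\inf_{\hat\tau}\ \sup_{\Theta\in\bar{\mathcal P}(u,r,s)}\mathbb P_\Theta(\hat K\ne K)\ \ge\ \frac14,$$ where the infimum is taken over all estimators $\hat\tau$ of the change-point vector $\tau$, and $\hat K=|\hat\tau|$ is the number of estimated change-points.
   Context: For $\Theta=(\theta_1,\dots,\theta_n)\in\mathbb R^{p\times n}$, $\mathbb P_\Theta$ is the distribution of $Y=(y_1,\dots,y_n)$ with $y_t=\theta_t+\varepsilon_t$, $\varepsilon_t$ i.i.d. $\mathcal N(0,\sigma^2I_p)$. The change-points of $\Theta$ are the integers $1=\tau_0<\tau_1<\dots<\tau_K<\tau_{K+1}=n+1$ such that $\theta_t=\mu_k$ for $\tau_k\le t<\tau_{k+1}$ and $\mu_k\neq\mu_{k-1}$; $K=K(\Theta)$ is their number. Put $\Delta_k=\|\mu_k-\mu_{k-1}\|$ (Euclidean norm), $r_k=\min(\tau_{k+1}-\tau_k,\tau_k-\tau_{k-1})$, $s_k=\|\mu_k-\mu_{k-1}\|_0$ (number of nonzero coordinates). $\bar{\mathcal P}(u,r,s)$ is the set of all $\Theta$ (with arbitrary $K\ge0$; constant $\Theta$, i.e. $K=0$, belong to it) such that every change-point $\tau_k$, $1\le k\le K$, satisfies $r_k\ge r$, $s_k\le s$ and $$r_k\Delta_k^2\ge\frac12\sigma^2\Big[s_k\log\Big(1+u\frac{\sqrt p}{s_k}\sqrt{\log\big(\tfrac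 n{r_k}\big)}\Big)+u\log\big(\tfrac n{r_k}\big)\Big].$$ An estimator $\hat\tau=(\hat\tau_1,\dots,\hat\tau_{\hat K})$ is any measurable function of $Y$ with values in finite increasing vectors. *)

(* Defs.v *)
From HB Require Import structures.
From mathcomp Require Import all_boot all_order all_algebra.
From mathcomp Require Import all_classical all_reals all_analysis.
From mathcomp Require Import zify.

Set Implicit Arguments.
Unset Strict Implicit.
Unset Printing Implicit Defensive.

Import Order.TTheory GRing.Theory Num.Theory.
Import numFieldNormedType.Exports.

Local Open Scope classical_set_scope.
Local Open Scope ring_scope.

Section iid.
Context {d : measure_display} {T : measurableType d} {R : realType}.

Definition tuple_cons n (z : T * n.-tuple T) : n.+1.-tuple T :=
  [tuple of z.1 :: z.2].

Lemma measurable_tuple_cons n : measurable_fun setT (@tuple_cons n).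
Proof. exact: measurable_cons. Qed.

HB.instance Definition _ n :=
  isMeasurableFun.Build _ _ _ _ (@tuple_cons n) (@measurable_tuple_cons n).

(* The law of an i.i.d. sample of size [n] from [P], on the product
   sigma-algebra of [n.-tuple T]; see [iid_prob_box]. *)
Fixpoint iid_prob (P : probability T R) n : probability (n.-tuple T) R :=
  match n with
  | 0 => dirac [tuple]
  | m.+1 => distribution (P \x iid_prob P m)%E (@tuple_cons m)
  end.

Lemma measurable_tuple_box n (A : 'I_n -> set T) :
  (forall i, measurable (A i)) ->
  measurable [set x : n.-tuple T | forall i, A i (tnth x i)].
Proof.
move=> mA.
rewrite (_ : mkset _ = \bigcap_(i in [set: 'I_n]) ((@tnth n T)^~ i @^-1` A i)).
  apply: fin_bigcap_measurable => // i _.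
  by rewrite -[X in measurable X]setTI; exact: measurable_tnth.
by apply/seteqP; split=> [x Ax i _|x Ax i]; [exact: Ax|exact: (Ax i)].
Qed.

Lemma iid_prob_box (P : probability T R) n (A : 'I_n -> set T) :
  (forall i, measurable (A i)) ->
  iid_prob P n [set x : n.-tuple T | forall i, A i (tnth x i)] =
  (\prod_(i < n) P (A i))%E.
Proof.
elim: n A => [|n IHn] A mA.
  rewrite big_ord0 /= diracE (_ : _ \in _ = true)//.
  by apply: mem_set; case.
rewrite big_ord_recl /= /distribution /pushforward.
rewrite (_ : _ @^-1` _ =
    A ord0 `*` [set x : n.-tuple T | forall i, A (lift ord0 i) (tnth x i)]).
  have mB := @measurable_tuple_box n (fun i => A (lift ord0 i)) (fun i => mA _).
  by rewrite [LHS]product_measure1E//; congr (_ * _)%E; exact: IHn.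
apply/seteqP; split=> [[x y] /= Axy|[x y] /= [Ax Ay] i].
  split; first by have := Axy ord0; rewrite (tnth_nth x).
  by move=> i; have := Axy (lift ord0 i); rewrite tnthS.
have [j|] := unliftP ord0 i => ->; last by rewrite (tnth_nth x).
by rewrite tnthS.
Qed.

End iid.

Section model.
Context {R : realType}.
Variables (p n : nat).
Implicit Types Theta : 'M[R]_(p, n).

(* [R^(p x n)] listed column by column, with its Borel (= product)
   sigma-algebra. *)
Definition data := n.-tuple (p.-tuple (measurableTypeR R)).

(* [normal_prob] is parameterized by the standard deviation. *)
Definition noise_prob (sigma : R) : probability data R :=
  iid_prob (iid_prob (normal_prob 0 sigma) p) n.

Definition observation Theta (eps : data) : data :=
  [tuple [tuple Theta i t + tnth (tnth eps t) i | i < p] | t < n].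

Lemma measurable_observation Theta : measurable_fun setT (observation Theta).
Proof.
apply/measurable_fun_tnthP => t; apply/measurable_fun_tnthP => i.
rewrite (_ : _ \o _ = fun eps : data => Theta i t + tnth (tnth eps t) i).
  apply: (@measurable_realfun.measurable_funD); first exact: measurable_cst.
  apply: (@measurableT_comp _ _ _ _ _ _
    (fun x : p.-tuple (measurableTypeR R) => tnth x i)).
    exact: measurable_tnth.
  exact: measurable_tnth.
by apply/funext => eps /=; rewrite !tnth_mktuple.
Qed.

HB.instance Definition _ Theta := isMeasurableFun.Build _ _ _ _
  (observation Theta) (measurable_observation Theta).

Definition data_prob (sigma : R) Theta : probability data R :=
  distribution (noise_prob sigma) (observation Theta).

End model.
Arguments data : clear implicits.

Section change_points.
Context {R : realType}.
Variables (p n : nat).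
Implicit Types (Theta : 'M[R]_(p, n)) (mu : nat -> 'cV[R]_p) (tau : seq nat).

(* [tau] lists tau_1, ..., tau_K; [boundary tau k] is tau_k for 0 <= k <= K+1,
   with tau_0 = 1 and tau_(K+1) = n+1 (the default value of [nth]). *)
Definition boundary tau (k : nat) : nat := nth n.+1 (1%N :: tau) k.

(* Times are numbered from 1, so column [t : 'I_n] is observed at time [t.+1].
   Only mu 0, ..., mu (size tau) matter. *)
Definition is_segmentation Theta tau mu : Prop :=
  [/\ sorted ltn (1%N :: rcons tau n.+1),
      forall (k : nat) (t : 'I_n), (k <= size tau)%N ->
        (boundary tau k <= t.+1 < boundary tau k.+1)%N -> col t Theta = mu k &
      forall k : nat, (1 <= k <= size tau)%N -> mu k <> mu k.-1].

Definition is_change_points Theta tau : Prop :=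
  exists mu, is_segmentation Theta tau mu.

(* For 0 < n this is the unique vector of change-points: [change_pointsP]. *)
Definition change_points Theta : seq nat :=
  xget [::] [set tau | is_change_points Theta tau].

Definition num_change_points Theta : nat := size (change_points Theta).

Let jump Theta (t : nat) : bool :=
  [exists i : 'I_n, exists j : 'I_n,
    [&& (i.+1 == j)%N, (j.+1 == t)%N & col i Theta != col j Theta]].

Let boundaryE tau k : boundary tau k = nth n.+1 (1%N :: rcons tau n.+1) k.
Proof.
case: k => //= k; rewrite /boundary /= nth_rcons.
have [//|tau_k] := ltnP k (size tau).
by rewrite nth_default//; case: ifP.
Qed.

Let boundary_lt tau i j : sorted ltn (1%N :: rcons tau n.+1) ->
  (i < j <= (size tau).+1)%N -> (boundary tau i < boundary tau j)%N.
Proof.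
move=> s /andP[ij jK]; rewrite !boundaryE.
apply: (sorted_ltn_nth ltn_trans) => //; rewrite inE /= size_rcons; lia.
Qed.

Let boundary_last tau : boundary tau (size tau).+1 = n.+1.
Proof. by rewrite /boundary /= nth_default. Qed.

Let mem_boundary tau k : (1 <= k <= size tau)%N -> boundary tau k \in tau.
Proof. by case: k => // k /= kK; apply: mem_nth. Qed.

Let boundary_mem tau t : t \in tau ->
  exists2 k, (1 <= k <= size tau)%N & boundary tau k = t.
Proof.
by move=> tt; exists (index t tau).+1; rewrite /= ?index_mem// /boundary/= nth_index.
Qed.

Let boundary_ex tau t : sorted ltn (1%N :: rcons tau n.+1) ->
  (1 <= t < n.+1)%N ->
  exists2 k, (k <= size tau)%N & (boundary tau k <= t < boundary tau k.+1)%N.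
Proof.
move=> s /andP[t1 tn].
have ex : exists k, (t < boundary tau k.+1)%N.
  by exists (size tau); rewrite boundary_last.
have [k tk kmin] := ex_minnP ex.
exists k; first by apply: kmin; rewrite boundary_last.
rewrite tk andbT; case: k tk kmin => // k tk kmin.
by rewrite leqNgt; apply/negP => /kmin; rewrite ltnn.
Qed.

Let mem_segmentation Theta tau mu : is_segmentation Theta tau mu ->
  tau =i jump Theta.
Proof.
move=> [s cmu jmu] t; apply/idP/idP.
  move=> /boundary_mem[k /andP[k1 kK] <-].
  have lt1 : (boundary tau 0 < boundary tau k)%N by apply: boundary_lt; lia.
  have lt2 : (boundary tau k.-1 < boundary tau k)%N by apply: boundary_lt; lia.
  have lt3 : (boundary tau k < boundary tau k.+1)%N by apply: boundary_lt; lia.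
  have : (boundary tau k < boundary tau (size tau).+1)%N.
    by apply: boundary_lt; lia.
  rewrite boundary_last => lt4; rewrite {1}/boundary/= in lt1.
  have ib : ((boundary tau k).-2 < n)%N by lia.
  have jb : ((boundary tau k).-1 < n)%N by lia.
  apply/existsP; exists (Ordinal ib); apply/existsP; exists (Ordinal jb).
  apply/and3P; split; [apply/eqP => /=; lia|apply/eqP => /=; lia|].
  rewrite (cmu k.-1) ?(cmu k) /= ?prednK//; try lia.
  by apply/eqP => /esym; apply: jmu; rewrite k1.
move=> /existsP[i /existsP[j /and3P[/eqP ij /eqP jt neq]]].
apply/negPn/negP => tN; move/eqP: neq; apply.
have [|k kK /andP[bt tb]] := @boundary_ex tau t s.
  by have := ltn_ord j; lia.
have {}bt : (boundary tau k < t)%N.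
  rewrite ltn_neqAle bt andbT; apply/eqP => kt.
  case: k => [|k] in kt kK bt tb *.
    by move: kt; rewrite /boundary /=; lia.
  by move/negP: tN; apply; rewrite -kt mem_boundary.
by rewrite !(cmu k)//; lia.
Qed.

Let change_points_uniq Theta tau tau' :
  is_change_points Theta tau -> is_change_points Theta tau' -> tau = tau'.
Proof.
have st t mu : is_segmentation Theta t mu -> sorted ltn t.
  by case=> /= /path_sorted + _ _; rewrite -cats1 => /cat_sorted2[].
move=> [mu h] [mu' h']; apply: (irr_sorted_eq ltn_trans ltnn).
- exact: st h.
- exact: st h'.
- by move=> t; rewrite (mem_segmentation h) (mem_segmentation h').
Qed.

Let change_points_ex Theta : (0 < n)%N ->
  is_change_points Theta [seq t <- iota 2 n.-1 | jump Theta t].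
Proof.
move=> n0; set tau := [seq t <- _ | _].
have tauP t : (t \in tau) = jump Theta t.
  rewrite mem_filter mem_iota; case: (boolP (jump Theta t)) => //=.
  move=> /existsP[i /existsP[j /and3P[/eqP ij /eqP jt _]]].
  by have := ltn_ord j; lia.
have tau2 t : t \in tau -> (2 <= t <= n)%N.
  by rewrite mem_filter mem_iota; lia.
have s : sorted ltn (1%N :: rcons tau n.+1).
  rewrite /= -cats1 cat_path /= andbT; apply/andP; split.
    rewrite path_min_sorted.
      by apply: sorted_filter; [exact: ltn_trans|exact: iota_ltn_sorted].
    by apply/allP => t /tau2; lia.
  have := mem_last 1%N tau; rewrite inE => /orP[/eqP ->|/tau2] /=; lia.
pose mu k : 'cV[R]_p := col (inord (boundary tau k).-1 : 'I_n.-1.+1)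
  (castmx (erefl, esym (prednK n0)) Theta).
have colE (t : 'I_n) (u : nat) : t = u :> nat ->
    col (inord u : 'I_n.-1.+1) (castmx (erefl, esym (prednK n0)) Theta) =
    col t Theta.
  move=> tu; apply/colP => i; rewrite !mxE castmxE/= cast_ord_id.
  congr (Theta _ _); apply/val_inj => /=; rewrite inordK// -tu prednK//.
have cmu (k : nat) (t : 'I_n) : (k <= size tau)%N ->
    (boundary tau k <= t.+1 < boundary tau k.+1)%N -> col t Theta = mu k.
  move=> kK; case: t => t; elim: t => [|t IHt] tn /andP[/= kt tk].
    rewrite /mu (@colE (Ordinal tn))//=.
    have : (0 < boundary tau k)%N; last lia.
    case: (k) kK => // k' kK.
    by have /tau2 := @mem_boundary tau k'.+1 kK; lia.
  move: kt; rewrite leq_eqVlt => /orP[/eqP kt|kt].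
    by rewrite /mu (@colE (Ordinal tn))//= kt.
  have tn' : (t < n)%N by lia.
  rewrite -(IHt tn'); last by rewrite /=; lia.
  apply/eqP/negPn/negP => neq.
  have /boundary_mem[l lK lt] : t.+2 \in tau.
    rewrite tauP; apply/existsP; exists (Ordinal tn'); apply/existsP.
    by exists (Ordinal tn); rewrite /= !eqxx/= eq_sym.
  have [lk|kl] := leqP l k.
    have : (boundary tau l <= boundary tau k)%N; last lia.
    move: lk; rewrite leq_eqVlt => /orP[/eqP->//|lk].
    by apply: ltnW; apply: boundary_lt => //; lia.
  have : (boundary tau k.+1 <= boundary tau l)%N; last lia.
  move: kl; rewrite leq_eqVlt => /orP[/eqP->//|kl].
  by apply: ltnW; apply: boundary_lt => //; lia.
exists mu; split=> // k kK eqmu.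
have lt2 : (boundary tau k.-1 < boundary tau k)%N by apply: boundary_lt; lia.
have lt3 : (boundary tau k < boundary tau k.+1)%N by apply: boundary_lt; lia.
have := mem_boundary kK; rewrite tauP.
move=> /existsP[i /existsP[j /and3P[/eqP ij /eqP jt /eqP]]]; apply.
rewrite (cmu k.-1) ?(cmu k)// ?prednK; lia.
Qed.

Lemma change_pointsP Theta tau : (0 < n)%N ->
  is_change_points Theta tau <-> tau = change_points Theta.
Proof.
move=> n0; have cp : is_change_points Theta (change_points Theta).
  exact: (xgetPex [::] (ex_intro _ _ (change_points_ex Theta n0))).
by split=> [|->//]; move/change_points_uniq; apply.
Qed.

End change_points.

Section signal_class.
Context {R : realType}.
Variables (p n : nat).

Definition l2norm (v : 'cV[R]_p) : R := Num.sqrt (\sum_i v i 0 ^+ 2).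

Definition l0norm (v : 'cV[R]_p) : nat := #|[set i | v i 0 != 0]%SET|.

Definition spacing (tau : seq nat) (k : nat) : nat :=
  minn (boundary n tau k.+1 - boundary n tau k)
       (boundary n tau k - boundary n tau k.-1).

Definition energy_threshold (sigma u : R) (r s : nat) : R :=
  2^-1 * sigma ^+ 2 *
  (s%:R * ln (1 + u * (Num.sqrt p%:R / s%:R) * Num.sqrt (ln (n%:R / r%:R)))
   + u * ln (n%:R / r%:R)).

Definition signal_class (sigma u : R) (r s : nat) : set 'M[R]_(p, n) :=
  [set Theta | exists tau mu, is_segmentation Theta tau mu /\
    forall k : nat, (1 <= k <= size tau)%N ->
      let rk := spacing tau k in
      let sk := l0norm (mu k - mu k.-1) in
      let Deltak := l2norm (mu k - mu k.-1) in
      [/\ (r <= rk)%N, (sk <= s)%N &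
          energy_threshold sigma u rk sk <= rk%:R * Deltak ^+ 2]].

End signal_class.
Arguments signal_class {R} p n sigma u r s.

HB.instance Definition _ := isPointed.Build (seq nat) [::].

HB.instance Definition _ := @isMeasurable.Build default_measure_display
  (seq nat) discrete_measurable discrete_measurable0
  discrete_measurableC discrete_measurableU.

Definition estimators (R : realType) (p n : nat) : set (data R p n -> seq nat) :=
  [set hattau | measurable_fun setT hattau /\ forall Y, sorted ltn (hattau Y)].
Arguments estimators : clear implicits.

(* Main.v *)
Require Import Defs.
From HB Require Import structures.
From mathcomp Require Import all_boot all_order all_algebra.
From mathcomp Require Import all_classical all_reals all_analysis.
From mathcomp Require Import measurable_realfun.
From mathcomp Require Import zify ring lra.

Set Implicit Arguments.
Unset Strict Implicit.
Unset Printing Implicit Defensive.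

Import Order.TTheory GRing.Theory Num.Theory.
Import numFieldNormedType.Exports.

Local Open Scope classical_set_scope.
Local Open Scope ring_scope.

(** The bound is a two-hypothesis testing bound.  The class contains the zero
    signal, and it contains the step signals that carry a vector [v] with one
    nonzero coordinate [a] on the first half of the times and vanish on the
    second half, as soon as [a ^+ 2] times half the number of times reaches the
    threshold: such a signal has one change-point, of sparsity 1 and of spacing
    [n./2 >= r].  An estimator that counts change-points correctly must
    therefore tell the zero signal from a step whose active coordinate [j] is
    drawn uniformly among the [p] coordinates, and this is hard.

    Let [L] be the likelihood ratio of the mixture of the steps with respect to
    pure noise.  From [min(1, L) >= L - L^2 / 4] the two error probabilities of
    any test sum to at least [1 - E(L^2) / 4] ([mixture_testing_bound]).  For
    Gaussian noise, [E(L^2)] is the mean over [j, k] of [exp(<T_j, T_k> /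
    sigma^2)] ([gaussian_mixture_testing]); here [T_j] and [T_k] are orthogonal
    for [j <> k], while at threshold energy the diagonal terms are at most
    [p + 1] ([expR_energy_threshold]).  Hence [E(L^2) <= 2], the errors sum to
    at least 1/2, and one of the signals has error at least 1/4.

    The Gaussian formula rests on one property of a map [h] of the sample space,
    [has_likelihood P h g]: composing an integrand with [h] amounts to weighting
    it by [g].  It is proved for a translation of the real line under the normal
    law ([normal_prob_likelihood]), carried to i.i.d. samples by Tonelli's
    theorem ([iid_prob_likelihood]), and used twice in a row to get the second
    moments without computing any Gaussian integral. *)

(** * Integration against a measure with a density *)

Section density.
Local Open Scope ereal_scope.
Context d (T : measurableType d) (R : realType).
Variables (mu nu : {measure set T -> \bar R}) (g : T -> R).
Hypotheses (mg : measurable_fun setT g) (g0 : forall x, (0 <= g x)%R).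
Hypothesis nuE : forall A, measurable A -> nu A = \int[mu]_(x in A) (g x)%:E.

Import HBNNSimple.

(** True by hypothesis for indicators, hence for simple functions by linearity,
    hence for [phi] by monotone convergence. *)
Lemma ge0_integral_density (phi : T -> \bar R) : measurable_fun setT phi ->
  (forall x, 0 <= phi x) ->
  \int[nu]_x phi x = \int[mu]_x ((g x)%:E * phi x).
Proof.
move=> mphi phi0; pose f_ := nnsfun_approx measurableT mphi.
have gE0 x : 0 <= (g x)%:E by rewrite lee_fin.
have mgE : measurable_fun setT (EFin \o g) by exact/measurable_EFinP.
have cvgf x : (f_ n x)%:E @[n --> \oo] --> phi x.
  by apply: cvg_nnsfun_approx => // t _; exact: phi0.
transitivity (limn (fun n => \int[nu]_x (f_ n x)%:E)).
  rewrite -monotone_convergence//=.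
  - by apply: eq_integral => x _; apply/esym/cvg_lim => //; exact: cvgf.
  - by move=> n; exact/measurable_EFinP.
  - by move=> n x _; rewrite lee_fin.
  - by move=> x _ m n mn; rewrite lee_fin; exact/lefP/nd_nnsfun_approx.
transitivity (limn (fun n => \int[mu]_x ((g x)%:E * (f_ n x)%:E))); last first.
  rewrite -monotone_convergence//=.
  - by apply: eq_integral => x _; apply/cvg_lim => //; exact: cvgeZl.
  - by move=> n; apply: emeasurable_funM => //; exact/measurable_EFinP.
  - by move=> n x _; rewrite mule_ge0// lee_fin.
  - move=> x _ m n mn; rewrite lee_wpmul2l// lee_fin.
    exact/lefP/nd_nnsfun_approx.
congr (limn _); apply/funext => n.
rewrite integralT_nnsfun sintegralE.
transitivity (\int[mu]_x \sum_(k \in range (f_ n))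
    (k%:E * ((g x)%:E * (\1_(f_ n @^-1` [set k]) x)%:E))); last first.
  apply: eq_integral => x _.
  rewrite (fimfunE (f_ n) x) -fsumEFin// ge0_mule_fsumr//.
    by apply: eq_fsbigr => k _; rewrite EFinM muleCA.
  by move=> k; rewrite EFinM nnfun_muleindic_ge0.
rewrite ge0_integral_fsum//.
- apply: eq_fsbigr => k /set_mem[t _ fk].
  rewrite nuE// ge0_integralZl_EFin//; last by rewrite -fk.
  + rewrite [in LHS]integral_mkcond; congr (_ * _); apply: eq_integral => x _.
    by rewrite epatch_indic.
  + by move=> x _; rewrite mule_ge0// lee_fin.
  + by apply: emeasurable_funM => //; exact/measurable_EFinP.
- move=> k; apply: emeasurable_funM => //.
  by apply: emeasurable_funM => //; exact/measurable_EFinP.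
- by move=> k x _; rewrite muleCA mule_ge0//; exact: nnfun_muleindic_ge0.
Qed.

End density.

(** * Likelihood ratios of Gaussian translations *)

(** The image of [P] under [h] has density [g] with respect to [P].  Quantifying
    over integrands rather than over sets makes the property stable under
    iterated integrals. *)
Definition has_likelihood d (T : measurableType d) (R : realType)
    (P : probability T R) (h : T -> T) (g : T -> R) :=
  forall phi : T -> \bar R, measurable_fun setT phi ->
    (forall x, (0 <= phi x)%E) ->
  (\int[P]_x phi (h x) = \int[P]_x ((g x)%:E * phi x))%E.

Section gaussian_shift.
Context {R : realType}.
Implicit Types (a sigma x : R).

Lemma measurable_shift a : measurable_fun setT (fun x : R => a + x).
Proof. exact: measurable_funD. Qed.

(** Translation preserves the length of intervals, which determines Lebesgue
    measure. *)
Lemma ge0_integral_lebesgue_shift a (f : R -> \bar R) :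
  measurable_fun setT f -> (forall x, (0 <= f x)%E) ->
  (\int[lebesgue_measure]_x f (a + x)%R = \int[lebesgue_measure]_x f x)%E.
Proof.
move=> mf f0.
have ma : measurable_fun setT
    (fun x : measurableTypeR R => a + x : measurableTypeR R).
  exact: measurable_shift.
transitivity (\int[pushforward lebesgue_measure
    (fun x : measurableTypeR R => (a + x)%R : measurableTypeR R)]_x f x)%E.
  by rewrite (ge0_integral_pushforward ma).
apply: eq_measure_integral => A mA _; apply/esym.
apply: (@lebesgue_measure_unique R) => // _ [[b c]] _ <-.
rewrite [RHS](_ : _ = lebesgue_measure `]b - a, c - a]%classic); last first.
  congr lebesgue_measure.
  by apply/seteqP; split => x /=; rewrite !in_itv/= ltrBlDl lerBrDl.
by rewrite !lebesgue_measure_itv/= !lte_fin ltrD2r -!EFinB opprB addrA subrK.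
Qed.

(** The ratio at [x] of the normal densities of standard deviation [sigma]
    centred at [a] and at 0. *)
Definition normal_likelihood sigma a x : R :=
  expR ((a * x - a ^+ 2 / 2) / sigma ^+ 2).

Lemma measurable_normal_likelihood sigma a :
  measurable_fun setT (normal_likelihood sigma a).
Proof.
apply: measurableT_comp => //; apply: measurable_funM => //.
by apply: measurable_funB => //; exact: measurable_funM.
Qed.

Lemma normal_pdf_shift sigma a x : sigma != 0 ->
  normal_pdf 0 sigma (x - a) =
  normal_likelihood sigma a x * normal_pdf 0 sigma x.
Proof.
move=> s0; rewrite /normal_pdf (negbTE s0) /normal_fun mulrCA -expRD.
congr (_ * expR _); rewrite !subr0 -mulr_natr; field.
by rewrite s0.
Qed.

Lemma normal_prob_likelihood sigma a : sigma != 0 ->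
  has_likelihood (normal_prob 0 sigma) (fun x => a + x)
    (normal_likelihood sigma a).
Proof.
move=> s0 phi mphi phi0.
have mpdf := @measurable_normal_pdf R 0 sigma.
have pdf0 := normal_pdf_ge0 0 sigma.
have dens f : measurable_fun setT f -> (forall x : R, (0 <= f x)%E) ->
    (\int[normal_prob 0 sigma]_x f x =
     \int[lebesgue_measure]_x ((normal_pdf 0 sigma x)%:E * f x))%E.
  exact: (@ge0_integral_density _ _ R lebesgue_measure (normal_prob 0 sigma)
    _ mpdf pdf0 (fun _ _ => erefl)).
rewrite [LHS]dens//; last first.
  exact: (measurableT_comp mphi (measurable_shift a)).
rewrite [RHS]dens//; last 2 first.
- apply: emeasurable_funM => //; apply/measurable_EFinP.
  exact: measurable_normal_likelihood.
- by move=> x; rewrite mule_ge0// lee_fin expR_ge0.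
rewrite -(@ge0_integral_lebesgue_shift (- a)); last 2 first.
- apply: emeasurable_funM; first exact/measurable_EFinP.
  exact: (measurableT_comp mphi (measurable_shift a)).
- by move=> x; rewrite mule_ge0// lee_fin.
apply: eq_integral => x _; rewrite /= addrA subrr add0r (addrC (- a)).
by rewrite normal_pdf_shift// EFinM -muleA muleCA.
Qed.

End gaussian_shift.

(** * Likelihood ratios of i.i.d. samples *)

Section iid_likelihood.
Context d (T : measurableType d) (R : realType) (P : probability T R).

Definition map_coords n (h : 'I_n -> T -> T) (x : n.-tuple T) : n.-tuple T :=
  [tuple h i (tnth x i) | i < n].

Lemma measurable_map_coords n (h : 'I_n -> T -> T) :
  (forall i, measurable_fun setT (h i)) -> measurable_fun setT (map_coords h).
Proof.
move=> mh; apply/measurable_fun_tnthP => i.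
rewrite (_ : _ \o _ = fun x => h i (tnth x i)); last first.
  by apply/funext => x /=; rewrite tnth_mktuple.
by apply: measurableT_comp => //; exact: measurable_tnth.
Qed.

Definition prod_coords n (g : 'I_n -> T -> R) (x : n.-tuple T) : R :=
  \prod_(i < n) g i (tnth x i).

Lemma measurable_prod_coords n (g : 'I_n -> T -> R) :
  (forall i, measurable_fun setT (g i)) -> measurable_fun setT (prod_coords g).
Proof.
move=> mg; apply: measurable_prod => i _.
by apply: measurableT_comp => //; exact: measurable_tnth.
Qed.

Lemma prod_coords_ge0 n (g : 'I_n -> T -> R) x :
  (forall i y, 0 <= g i y) -> 0 <= prod_coords g x.
Proof. by move=> g0; exact: prodr_ge0. Qed.

Lemma map_coords_cons n (h : 'I_n.+1 -> T -> T) x y :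
  map_coords h (tuple_cons (x, y)) =
  tuple_cons (h ord0 x, map_coords (fun i => h (lift ord0 i)) y).
Proof.
apply: eq_from_tnth => i; rewrite tnth_mktuple.
have [j|] := unliftP ord0 i => ->; last by rewrite !(tnth_nth x).
by rewrite !tnthS tnth_mktuple.
Qed.

Lemma prod_coords_cons n (g : 'I_n.+1 -> T -> R) x y :
  prod_coords g (tuple_cons (x, y)) =
  g ord0 x * prod_coords (fun i => g (lift ord0 i)) y.
Proof.
rewrite /prod_coords big_ord_recl (tnth_nth x)/=; congr (_ * _).
by apply: eq_bigr => i _; rewrite tnthS.
Qed.

Lemma ge0_integral_iid_prob_cons n (F : n.+1.-tuple T -> \bar R) :
  measurable_fun setT F -> (forall x, (0 <= F x)%E) ->
  (\int[iid_prob P n.+1]_x F x =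
   \int[P]_x \int[iid_prob P n]_y F (tuple_cons (x, y)))%E.
Proof.
move=> mF F0; rewrite /= /distribution.
rewrite (ge0_integral_pushforward (measurable_funPT (@tuple_cons d T n)))//=.
rewrite fubini_tonelli1//.
exact: (measurableT_comp mF (@measurable_tuple_cons d T n)).
Qed.

(** Tonelli's theorem isolates the first coordinate: the induction hypothesis
    replaces the other coordinates, at the already transformed first one, and
    the inner integral is then an integrand for the first coordinate. *)
Lemma iid_prob_likelihood n (h : 'I_n -> T -> T) (g : 'I_n -> T -> R) :
  (forall i, measurable_fun setT (h i)) ->
  (forall i, measurable_fun setT (g i)) ->
  (forall i x, 0 <= g i x) ->
  (forall i, has_likelihood P (h i) (g i)) ->
  has_likelihood (iid_prob P n) (map_coords h) (prod_coords g).
Proof.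
elim: n h g => [|n IHn] h g mh mg g0 hg phi mphi phi0.
  have mc f : measurable_fun [set: 0.-tuple T] (f : 0.-tuple T -> \bar R).
    rewrite (_ : f = cst (f [tuple])); first exact: measurable_cst.
    by apply/funext => x; rewrite (tuple0 x).
  rewrite /= !integral_dirac// !diracT !mul1e.
  by rewrite /prod_coords big_ord0 mul1e (tuple0 (map_coords _ _)).
have mH := measurable_map_coords mh; have mG := measurable_prod_coords mg.
set h' := fun i : 'I_n => h (lift ord0 i).
set g' := fun i : 'I_n => g (lift ord0 i).
have mG' : measurable_fun setT (prod_coords g').
  by apply: measurable_prod_coords => i; exact: mg.
have G0 y : 0 <= prod_coords g' y by apply: prod_coords_ge0 => i x; exact: g0.
rewrite ge0_integral_iid_prob_cons//; last exact: (measurableT_comp mphi mH).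
rewrite ge0_integral_iid_prob_cons//; last 2 first.
- by apply: emeasurable_funM => //; exact/measurable_EFinP.
- by move=> x; rewrite mule_ge0// lee_fin prod_coords_ge0.
pose f (z : T * n.-tuple T) : \bar R :=
  ((prod_coords g' z.2)%:E * phi (tuple_cons z))%E.
have mf : measurable_fun setT f.
  apply: emeasurable_funM.
    by apply/measurable_EFinP; exact: measurableT_comp.
  exact: (measurableT_comp mphi (@measurable_tuple_cons d T n)).
have f0 z : (0 <= f z)%E by rewrite mule_ge0// lee_fin.
pose psi x := (\int[iid_prob P n]_y f (x, y))%E.
have mpsi : measurable_fun setT psi.
  exact: (measurable_fun_fubini_tonelli_F f mf f0).
transitivity (\int[P]_x psi (h ord0 x))%E.
  apply: eq_integral => x _; rewrite /psi /f /=.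
  under eq_integral do rewrite map_coords_cons.
  rewrite (IHn h' g' _ _ _ _ (fun y => phi (tuple_cons (h ord0 x, y))))//.
  - by move=> i; exact: mh.
  - by move=> i; exact: mg.
  - by move=> i y; exact: g0.
  - by move=> i; exact: hg.
  - apply: (measurableT_comp mphi).
    exact: (measurableT_comp (@measurable_tuple_cons d T n) (measurable_pair1 _)).
rewrite (hg ord0)//; last by move=> x; exact: integral_ge0.
apply: eq_integral => x _; rewrite /psi -ge0_integralZl_EFin//; last first.
  exact: (measurableT_comp mf (measurable_pair1 _)).
by apply: eq_integral => y _; rewrite /f prod_coords_cons EFinM -muleA.
Qed.

End iid_likelihood.

(** * Testing against a mixture with bounded second moment *)

(** The [g j] are the densities of the alternatives, and [c] is the Gram matrix
    of these densities. *)
Section second_moment.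
Context d (T : measurableType d) (R : realType) (P : probability T R).
Variables (m : nat) (g : 'I_m -> T -> R) (c : 'I_m -> 'I_m -> R).
Hypotheses (m0 : (0 < m)%N) (mg : forall j, measurable_fun setT (g j))
  (g0 : forall j x, 0 <= g j x)
  (g1 : forall j, (\int[P]_x (g j x)%:E = 1)%E)
  (g2 : forall j k, (\int[P]_x (g j x * g k x)%:E = (c j k)%:E)%E)
  (c2 : \sum_j \sum_k c j k <= 2 * m%:R ^+ 2).

(** The inequality [x - x^2 / 4 <= min(1, x)], that is [0 <= (x / 2 - 1)^2], where
    [b] selects which of the two terms of the minimum is paid. *)
Lemma le_min1_second_moment (b : bool) (x : R) : 0 <= x ->
  x <= (~~ b)%:R + x * b%:R + 4^-1 * x ^+ 2.
Proof.
move=> x0; have := sqr_ge0 (x / 2 - 1); have := sqr_ge0 x.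
case: b => /=; rewrite ?mulr0 ?mulr1 ?mulr1n ?mulr0n; lra.
Qed.

(** Integrate the previous inequality at the mixture density [L], with [b] the
    indicator of [A]: the left-hand side integrates to 1 and [L^2] to at most
    2. *)
Lemma mixture_testing_bound (A : set T) : measurable A ->
  ((2^-1)%:E <= P (~` A) +
    (m%:R^-1)%:E * \sum_j \int[P]_x (g j x * \1_A x)%:E)%E.
Proof.
move=> mA; have mR : (m%:R != 0 :> R) by rewrite pnatr_eq0 -lt0n.
have mV0 : 0 <= m%:R^-1 :> R by rewrite invr_ge0.
pose L x := m%:R^-1 * \sum_j g j x.
have L0 x : 0 <= L x by rewrite mulr_ge0// sumr_ge0.
have mL : measurable_fun setT L.
  by apply: measurable_funM => //; exact: measurable_sum.
have intL : (\int[P]_x (L x)%:E = 1)%E.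
  under eq_integral do rewrite EFinM -sumEFin.
  rewrite ge0_integralZl_EFin//=; last 2 first.
  - by move=> x _; rewrite sume_ge0// => j _; rewrite lee_fin.
  - by apply: emeasurable_sum => j; exact/measurable_EFinP.
  rewrite ge0_integral_sum//=; last 2 first.
  - by move=> j; exact/measurable_EFinP.
  - by move=> j x _; rewrite lee_fin.
  under eq_bigr do rewrite g1.
  by rewrite sumEFin sumr_const card_ord -EFinM mulVf.
have intLA : (\int[P]_x (L x * \1_A x)%:E =
    (m%:R^-1)%:E * \sum_j \int[P]_x (g j x * \1_A x)%:E)%E.
  under eq_integral do rewrite -mulrA mulr_suml EFinM -sumEFin.
  rewrite ge0_integralZl_EFin//=; last 2 first.
  - by move=> x _; rewrite sume_ge0// => j _; rewrite lee_fin mulr_ge0.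
  - apply: emeasurable_sum => j; apply/measurable_EFinP.
    exact: measurable_funM.
  rewrite ge0_integral_sum//=.
  - by move=> j; apply/measurable_EFinP; exact: measurable_funM.
  - by move=> j x _; rewrite lee_fin mulr_ge0.
have intL2 : (\int[P]_x (L x ^+ 2)%:E <= 2%:E)%E.
  under eq_integral => x _.
    rewrite /L exprMn (expr2 (\sum_j _)) mulr_suml.
    under eq_bigr do rewrite mulr_sumr.
    rewrite EFinM -sumEFin.
    under eq_bigr do rewrite -sumEFin.
    over.
  rewrite ge0_integralZl_EFin//=; last 2 first.
  - move=> x _; apply: sume_ge0 => j _; apply: sume_ge0 => k _.
    by rewrite lee_fin mulr_ge0.
  - apply: emeasurable_sum => j; apply: emeasurable_sum => k.
    by apply/measurable_EFinP; exact: measurable_funM.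
  rewrite ge0_integral_sum//=; last 2 first.
  - move=> j; apply: emeasurable_sum => k.
    by apply/measurable_EFinP; exact: measurable_funM.
  - by move=> j x _; apply: sume_ge0 => k _; rewrite lee_fin mulr_ge0.
  under eq_bigr => j _.
    rewrite ge0_integral_sum//=; last 2 first.
    - by move=> k; apply/measurable_EFinP; exact: measurable_funM.
    - by move=> k x _; rewrite lee_fin mulr_ge0.
    under eq_bigr do rewrite g2.
    rewrite sumEFin.
    over.
  rewrite sumEFin -EFinM lee_fin exprVn mulrC ler_pdivrMr//.
  by rewrite exprn_gt0// ltr0n.
have mA' : measurable_fun setT (\1_A : T -> R) by exact: measurable_indic.
have mC : measurable_fun setT (\1_(~` A) : T -> R).
  by apply: measurable_indic; exact: measurableC.
have key : (1 <= P (~` A) + \int[P]_x (L x * \1_A x)%:E +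
    (4^-1)%:E * \int[P]_x (L x ^+ 2)%:E)%E.
  have -> : (P (~` A) = \int[P]_x (\1_(~` A) x)%:E)%E.
    by rewrite integral_indic ?setIT//; exact: measurableC.
  rewrite -intL.
  rewrite -ge0_integralD//=; last 3 first.
  - exact/measurable_EFinP.
  - by move=> x _; rewrite lee_fin mulr_ge0.
  - by apply/measurable_EFinP; exact: measurable_funM.
  rewrite -ge0_integralZl_EFin//=; last 2 first.
  - by move=> x _; rewrite lee_fin exprn_ge0.
  - by apply/measurable_EFinP; exact: measurable_funX.
  rewrite -ge0_integralD//=; last 4 first.
  - by move=> x _; rewrite -EFinD lee_fin addr_ge0// mulr_ge0.
  - apply/measurable_EFinP; apply: measurable_funD => //.
    exact: measurable_funM.
  - by move=> x _; rewrite -EFinM lee_fin mulr_ge0// exprn_ge0.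
  - apply/measurable_EFinP; apply: measurable_funM => //.
    exact: measurable_funX.
  apply: ge0_le_integral => //=.
  - by move=> x _; rewrite lee_fin.
  - exact/measurable_EFinP.
  - apply/measurable_EFinP; apply: measurable_funD.
      by apply: measurable_funD => //; exact: measurable_funM.
    by apply: measurable_funM => //; exact: measurable_funX.
  - move=> x _; rewrite -EFinM -!EFinD lee_fin !indicE in_setC.
    exact: le_min1_second_moment.
rewrite -intLA; move: key.
set a := (P _ + _)%E => key.
have {}key : (1 <= a + (2^-1)%:E)%E.
  apply: le_trans key _; rewrite leeD2l//.
  rewrite (_ : 2^-1 = 4^-1 * 2 :> R); last by field.
  by rewrite EFinM lee_wpmul2l// lee_fin.
case: a key => [a| |]//=.
- by rewrite -EFinD !lee_fin; lra.
- by move=> _; exact: leey.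
Qed.

End second_moment.

(** * Testing for Gaussian signals *)

Section gaussian_testing.
Context {R : realType}.
Variables (p n : nat) (sigma : R).
Hypothesis sigma0 : sigma != 0.
Implicit Types Theta : 'M[R]_(p, n).

Definition likelihood Theta : data R p n -> R :=
  prod_coords (fun t => prod_coords (fun i =>
    normal_likelihood sigma (Theta i t))).

Lemma measurable_likelihood Theta : measurable_fun setT (likelihood Theta).
Proof.
apply: measurable_prod_coords => t; apply: measurable_prod_coords => i.
exact: measurable_normal_likelihood.
Qed.

Lemma likelihood_ge0 Theta y : 0 <= likelihood Theta y.
Proof.
by apply: prod_coords_ge0 => t x; apply: prod_coords_ge0 => i z; exact: expR_ge0.
Qed.

Lemma noise_prob_likelihood Theta :
  has_likelihood (noise_prob p n sigma) (observation Theta) (likelihood Theta).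
Proof.
have mh t i : measurable_fun setT (fun x : measurableTypeR R =>
    Theta i t + x : measurableTypeR R).
  exact: measurable_shift.
rewrite (_ : observation Theta =
  map_coords (fun t => map_coords (fun i (x : measurableTypeR R) =>
    Theta i t + x : measurableTypeR R))); last first.
  apply/funext => y; apply: eq_from_tnth => t; apply: eq_from_tnth => i.
  by rewrite !tnth_mktuple.
apply: iid_prob_likelihood => [t|t|t x|t].
- exact: measurable_map_coords.
- apply: measurable_prod_coords => i; exact: measurable_normal_likelihood.
- by apply: prod_coords_ge0 => i z; exact: expR_ge0.
- apply: iid_prob_likelihood => // [i|i x|i].
  + exact: measurable_normal_likelihood.
  + exact: expR_ge0.
  + exact: normal_prob_likelihood.
Qed.

Definition mx_dot Theta Theta' : R := \sum_t \sum_i Theta i t * Theta' i t.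

(** The exponent of the likelihood is affine in the data, so translating the
    data multiplies it by a constant. *)
Lemma likelihood_observation Theta Theta' y :
  likelihood Theta' (observation Theta y) =
  expR (mx_dot Theta Theta' / sigma ^+ 2) * likelihood Theta' y.
Proof.
rewrite /likelihood /prod_coords /mx_dot mulr_suml expR_sum -big_split/=.
apply: eq_bigr => t _; rewrite mulr_suml expR_sum -big_split/=.
apply: eq_bigr => i _; rewrite !tnth_mktuple /normal_likelihood -expRD.
by congr expR; rewrite -mulrDl; congr (_ / _); ring.
Qed.

Lemma integral_likelihood Theta :
  (\int[noise_prob p n sigma]_y (likelihood Theta y)%:E = 1)%E.
Proof.
have := @noise_prob_likelihood Theta (cst 1%E) (measurable_cst _)
  (fun=> lee01).
rewrite integral_cst// mul1e => lik1.
rewrite -[RHS](@probability_setT _ _ _ (noise_prob p n sigma)) [RHS]lik1.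
by apply: eq_integral => y _; rewrite mule1.
Qed.

(** One of the two likelihoods is absorbed by translating the data, which turns
    the other into a constant multiple of itself. *)
Lemma integral_likelihoodM Theta Theta' :
  (\int[noise_prob p n sigma]_y (likelihood Theta y * likelihood Theta' y)%:E =
   (expR (mx_dot Theta Theta' / sigma ^+ 2))%:E)%E.
Proof.
under eq_integral do rewrite EFinM.
rewrite -(@noise_prob_likelihood Theta (EFin \o likelihood Theta')); last 2 first.
- by apply/measurable_EFinP; exact: measurable_likelihood.
- by move=> y; rewrite lee_fin likelihood_ge0.
under eq_integral do rewrite /= likelihood_observation EFinM.
rewrite ge0_integralZl_EFin ?expR_ge0//.
- by rewrite integral_likelihood mule1.
- by move=> y _; rewrite lee_fin likelihood_ge0.
- by apply/measurable_EFinP; exact: measurable_likelihood.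
Qed.

Lemma data_probE Theta A : measurable A ->
  data_prob sigma Theta A =
  (\int[noise_prob p n sigma]_y (likelihood Theta y * \1_A y)%:E)%E.
Proof.
move=> mA.
have mO : measurable (observation Theta @^-1` A).
  by rewrite -[X in measurable X]setTI; exact: measurable_observation.
transitivity (\int[noise_prob p n sigma]_y
    (\1_(observation Theta @^-1` A) y)%:E)%E.
  by rewrite integral_indic// setIT.
under [RHS]eq_integral do rewrite EFinM.
rewrite -(@noise_prob_likelihood Theta (EFin \o \1_A))//.
- by apply/measurable_EFinP; exact: measurable_indic.
- by move=> y; rewrite lee_fin.
Qed.

Lemma likelihood0 y : likelihood 0 y = 1.
Proof.
apply: big1 => t _; apply: big1 => i _.
by rewrite /normal_likelihood mxE mul0r expr0n mul0r subr0 mul0r expR0.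
Qed.

Lemma gaussian_mixture_testing m (Th : 'I_m -> 'M[R]_(p, n)) A :
  (0 < m)%N -> measurable A ->
  \sum_j \sum_k expR (mx_dot (Th j) (Th k) / sigma ^+ 2) <= 2 * m%:R ^+ 2 ->
  ((2^-1)%:E <= data_prob sigma (0 : 'M[R]_(p, n)) (~` A) +
    (m%:R^-1)%:E * \sum_j data_prob sigma (Th j) A)%E.
Proof.
move=> m0 mA c2.
have -> : data_prob sigma (0 : 'M[R]_(p, n)) (~` A) =
    noise_prob p n sigma (~` A).
  rewrite data_probE; last exact: measurableC.
  under eq_integral do rewrite likelihood0 mul1r.
  by rewrite integral_indic ?setIT//; exact: measurableC.
under [X in (_ * X)%E]eq_bigr do rewrite data_probE//.
apply: (@mixture_testing_bound _ _ _ _ _ (fun j => likelihood (Th j))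
  (fun j k => expR (mx_dot (Th j) (Th k) / sigma ^+ 2))) => //.
- by move=> j; exact: measurable_likelihood.
- by move=> j x; exact: likelihood_ge0.
- by move=> j; exact: integral_likelihood.
- by move=> j k; exact: integral_likelihoodM.
Qed.

End gaussian_testing.

(** * Step signals *)

Section step_signals.
Context {R : realType}.
Variables (p n : nat).

Definition step_signal (m : nat) (v : 'cV[R]_p) : 'M[R]_(p, n) :=
  \matrix_(i, t) if (t < m)%N then v i 0 else 0.

Lemma is_segmentation_step m v : (0 < m < n)%N -> v != 0 ->
  is_segmentation (step_signal m v) [:: m.+1]
    (fun k => if k == 0%N then v else 0).
Proof.
move=> /andP[m0 mn] v0; split.
- by rewrite /= !ltnS m0 mn.
- move=> [|[|k]] t //= _; rewrite /boundary/= => tm.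
    by apply/colP => i; rewrite !mxE ifT//; lia.
  by apply/colP => i; rewrite !mxE ifF//; lia.
- by move=> [|[|k]]//= _; apply/eqP; rewrite eq_sym.
Qed.

Lemma is_segmentation0 : (0 < n)%N ->
  is_segmentation (0 : 'M[R]_(p, n)) [::] (fun=> 0).
Proof.
move=> n0; split=> //.
- by rewrite /= ltnS n0.
- by move=> k t _ _; apply/colP => i; rewrite !mxE.
- by move=> [].
Qed.

Lemma num_change_points_segmentation (Theta : 'M[R]_(p, n)) tau mu :
  (0 < n)%N -> is_segmentation Theta tau mu -> num_change_points Theta = size tau.
Proof.
move=> n0 seg; rewrite /num_change_points.
by have [-> //] : is_change_points Theta tau <-> _ := change_pointsP Theta tau n0;
  exists mu.
Qed.

Lemma signal_class0 sigma u r s : (0 < n)%N ->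
  signal_class p n sigma u r s (0 : 'M[R]_(p, n)).
Proof.
move=> n0; exists [::], (fun=> 0); split; first exact: is_segmentation0.
by move=> [].
Qed.

Lemma mx_dot_step m (v w : 'cV[R]_p) : (m <= n)%N ->
  mx_dot (step_signal m v) (step_signal m w) =
  m%:R * \sum_i v i 0 * w i 0.
Proof.
move=> mn; rewrite /mx_dot.
transitivity (\sum_(t < n) if (t < m)%N then \sum_i v i 0 * w i 0 else 0).
  apply: eq_bigr => t _; case: ifPn => tm.
    by apply: eq_bigr => i _; rewrite !mxE tm.
  by apply: big1 => i _; rewrite !mxE (negbTE tm) mul0r.
rewrite -big_mkcond/= -(big_ord_widen n (fun=> \sum_i v i 0 * w i 0) mn).
by rewrite sumr_const card_ord mulr_natl.
Qed.

Lemma l2norm_delta j (a : R) : 0 <= a ->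
  l2norm (a *: delta_mx j 0 : 'cV[R]_p) = a.
Proof.
move=> a0; rewrite /l2norm (bigD1 j)//= big1 => [|i ij]; last first.
  by rewrite !mxE (negbTE ij) mulr0 expr0n.
by rewrite !mxE !eqxx mulr1 addr0 sqrtr_sqr ger0_norm.
Qed.

Lemma l0norm_delta j (a : R) : a != 0 ->
  l0norm (a *: delta_mx j 0 : 'cV[R]_p) = 1%N.
Proof.
move=> a0; rewrite /l0norm (_ : [set _ | _]%SET = [set j]%SET) ?cards1//.
apply/setP => i; rewrite !inE !mxE eqxx andbT.
by case: (i == j); rewrite ?mulr1 ?mulr0 ?a0 ?eqxx.
Qed.

Lemma sum_delta j k (a : R) :
  \sum_i (a *: delta_mx j 0 : 'cV[R]_p) i 0 * (a *: delta_mx k 0 : 'cV[R]_p) i 0 =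
  if j == k then a ^+ 2 else 0.
Proof.
rewrite (bigD1 j)//= big1 => [|i ij]; last first.
  by rewrite !mxE (negbTE ij) mulr0 mul0r.
rewrite !mxE !eqxx mulr1 addr0.
by case: eqP => _; rewrite ?mulr1 ?mulr0.
Qed.

(** The first segment has length [m] and the second at least [m], so the spacing
    is [m]. *)
Lemma signal_class_step sigma u r s m j (a : R) :
  (0 < m)%N -> (m.*2 <= n)%N -> (r <= m)%N -> (1 <= s)%N -> 0 < a ->
  energy_threshold p n sigma u m 1 <= m%:R * a ^+ 2 ->
  signal_class p n sigma u r s (step_signal m (a *: delta_mx j 0)).
Proof.
move=> m0 mn rm s1 a0 thr.
have v0 : a *: delta_mx j 0 != 0 :> 'cV[R]_p.
  apply/eqP => /colP/(_ j); rewrite !mxE !eqxx mulr1 => /eqP.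
  by rewrite gt_eqF.
exists [:: m.+1], (fun k => if k == 0%N then a *: delta_mx j 0 else 0).
split; first by apply: is_segmentation_step => //; lia.
move=> [|[|k]]//= _.
have -> : spacing n [:: m.+1] 1 = m by rewrite /spacing /boundary/=; lia.
have -> : 0 - a *: delta_mx j 0 = (- a) *: delta_mx j 0 :> 'cV[R]_p.
  by rewrite sub0r scaleNr.
rewrite l0norm_delta ?oppr_eq0 ?gt_eqF//; split => //.
rewrite scaleNr (_ : l2norm _ = a)// -[RHS](l2norm_delta j (ltW a0)).
by congr Num.sqrt; apply: eq_bigr => i _; rewrite !mxE sqrrN.
Qed.

End step_signals.

(** * Energy at the threshold *)

Section energy.
Context {R : realType}.
Variables (p n : nat).

(** The threshold is half the sum of a logarithm [ln (1 + u * sqrt p * sqrt l)]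
    and of [u * l], where [l = ln (n / m) <= ln 4].  Each is at most
    [ln (p + 1)]: the first because [u * sqrt l <= 1] and [sqrt p <= p], the
    second because [u * ln 4 <= ln 2]. *)
Lemma expR_energy_threshold (sigma u : R) (m : nat) :
  0 < u -> u < 8^-1 -> sigma != 0 -> (1 <= p)%N ->
  (0 < m)%N -> (m <= n)%N -> (n <= 4 * m)%N ->
  expR (energy_threshold p n sigma u m 1 / sigma ^+ 2) <= p%:R + 1.
Proof.
move=> u0 u8 s0 p1 m0 mn nm.
have mR : 0 < m%:R :> R by rewrite ltr0n.
have pR : 1 <= p%:R :> R by rewrite ler1n.
set q := n%:R / m%:R : R.
have q1 : 1 <= q by rewrite ler_pdivlMr// mul1r ler_nat.
have q4 : q <= 4 by rewrite ler_pdivrMr// -natrM ler_nat.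
have L0 : 0 <= ln q by exact: ln_ge0.
have Lln4 : ln q <= ln 4 by rewrite ler_ln// posrE; lra.
have L4 : ln q <= 4.
  by rewrite (le_trans (ltW (ln_sublinear _)))//; lra.
have sL : Num.sqrt (ln q) <= 2.
  rewrite -(@ler_pXn2r _ 2) ?nnegrE ?sqrtr_ge0// sqr_sqrtr//.
  by apply: (le_trans L4); lra.
have sp : Num.sqrt p%:R <= p%:R :> R.
  rewrite -[leRHS]ger0_norm// -sqrtr_sqr ler_wsqrtr// expr2.
  by rewrite ler_peMl//; lra.
have sp0 := sqrtr_ge0 (p%:R : R); have sL0 := sqrtr_ge0 (ln q).
have lnp : ln (1 + u * (Num.sqrt p%:R / 1) * Num.sqrt (ln q)) <= ln (p%:R + 1).
  have pq : Num.sqrt p%:R * Num.sqrt (ln q) <= p%:R * 2 by exact: ler_pM.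
  have pq0 : 0 <= Num.sqrt p%:R * Num.sqrt (ln q) by exact: mulr_ge0.
  rewrite divr1 -mulrA ler_ln ?posrE; nra.
have ln2 : u * ln q <= ln (p%:R + 1).
  have : ln 4 = 2 * ln 2 :> R.
    by rewrite (_ : 4 = 2 * 2) ?lnM ?posrE//; lra.
  have : ln 2 <= ln (p%:R + 1) :> R by rewrite ler_ln ?posrE; lra.
  nra.
rewrite -[leRHS]lnK ?posrE; last by lra.
rewrite ler_expR /energy_threshold -/q mul1r mulrAC mulfK; last by rewrite sqrf_eq0.
lra.
Qed.

End energy.

(** * The lower bound *)

Section conclusion.
Context {R : realType}.

Lemma quarter_le_worst_error (p : nat) (S a : \bar R) (b : 'I_p -> \bar R) :
  (0 < p)%N -> (0 <= S)%E -> (a <= S)%E -> (forall j, b j <= S)%E ->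
  ((2^-1)%:E <= a + (p%:R^-1)%:E * \sum_j b j)%E -> ((4^-1)%:E <= S)%E.
Proof.
case: S => [S| |]// p0 _ aS bS; last by rewrite leey.
have pR : p%:R != 0 :> R by rewrite pnatr_eq0 -lt0n.
have bsum : (\sum_j b j <= \sum_(j < p) S%:E)%E by apply: lee_sum.
move=> /le_trans/(_ (leeD aS (lee_wpmul2l _ bsum))).
rewrite sumEFin sumr_const card_ord -EFinM -EFinD !lee_fin.
rewrite -[S *+ p]mulr_natl mulKf// invr_ge0 ler0n => /(_ isT).
lra.
Qed.

End conclusion.

Theorem theorem2 (R : realType) (u : R) (u_gt0 : 0 < u) (u_lt : u < 8^-1)
    (sigma : R) (sigma_gt0 : 0 < sigma)
    (n p : nat) (n_ge2 : (2 <= n)%N) (p_ge1 : (1 <= p)%N)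
    (r : nat) (r_ge1 : (1 <= r)%N) (r_le : r%:R <= n%:R / 4 :> R)
    (s : nat) (s_ge1 : (1 <= s)%N) (s_le : (s <= p)%N) :
  ((4^-1)%:E <=
   ereal_inf [set
     ereal_sup [set
       data_prob sigma Theta
         [set Y | size (hattau Y) <> num_change_points Theta]
       | Theta in signal_class p n sigma u r s]
     | hattau in estimators R p n])%E.
Proof.
have r4 : (4 * r <= n)%N.
  by rewrite -(ler_nat R) natrM mulrC -ler_pdivlMr.
have sigma0 : sigma != 0 by rewrite gt_eqF.
have n0 : (0 < n)%N by lia.
pose m := n./2.
have m0 : (0 < m)%N by rewrite /m; lia.
have mR : 0 < m%:R :> R by rewrite ltr0n.
pose E := energy_threshold p n sigma u m 1.
have E0 : 0 < E.
  have lnq : 0 < ln (n%:R / m%:R) :> R.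
    by rewrite ln_gt0// ltr_pdivlMr// mul1r ltr_nat /m; lia.
  rewrite /E /energy_threshold mulr_gt0//; first by rewrite mulr_gt0// exprn_gt0.
  rewrite ltr_wpDl//; last exact: mulr_gt0.
  rewrite mul1r ln_ge0// lerDl mulr_ge0 ?sqrtr_ge0// mulr_ge0 ?(ltW u_gt0)//.
pose a := Num.sqrt (E / m%:R).
have a0 : 0 < a by rewrite sqrtr_gt0 divr_gt0.
have a2 : m%:R * a ^+ 2 = E.
  by rewrite sqr_sqrtr ?divr_ge0 ?ltW// mulrC divfK// gt_eqF.
pose Th (j : 'I_p) : 'M[R]_(p, n) := step_signal n m (a *: delta_mx j 0).
apply: le_ereal_inf_tmp => _ [hattau [mhat _] <-].
set S := ereal_sup _.
have msize (P : set nat) : measurable [set Y | P (size (hattau Y))].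
  rewrite -[X in measurable X]setTI.
  exact: (mhat measurableT [set t | P (size t)]).
pose A := [set Y | size (hattau Y) = 0%N].
have S_Th j : (data_prob sigma (Th j) A <= S)%E.
  have ThC : signal_class p n sigma u r s (Th j).
    by apply: signal_class_step; rewrite ?a2// /m; lia.
  apply: le_trans (ereal_sup_ubound _); last by exists (Th j).
  have -> : num_change_points (Th j) = 1%N.
    apply: (num_change_points_segmentation n0 (is_segmentation_step _ _)).
      by rewrite /m; lia.
    apply/eqP => /colP/(_ j); rewrite !mxE !eqxx mulr1 => /eqP.
    by rewrite gt_eqF.
  apply: le_measure; rewrite ?inE; [exact: (msize [set 0%N])| |].
    exact: (msize [set k | k <> 1%N]).
  by move=> Y; rewrite /A /= => ->.
have S_0 : (data_prob sigma (0 : 'M[R]_(p, n)) (~` A) <= S)%E.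
  apply: ereal_sup_ubound; exists 0; first exact: signal_class0.
  by rewrite (num_change_points_segmentation n0 (is_segmentation0 p n0)).
apply: (quarter_le_worst_error p_ge1 _ S_0 S_Th).
  exact: le_trans S_0.
apply: gaussian_mixture_testing => //; first exact: (msize [set 0%N]).
(* Distinct steps are orthogonal and contribute 1; the diagonal contributes at
   most p + 1. *)
have expTh j k : expR (mx_dot (Th j) (Th k) / sigma ^+ 2) <=
    1 + (j == k)%:R * p%:R.
  rewrite mx_dot_step; last by rewrite /m; lia.
  rewrite sum_delta; case: (j == k).
    rewrite a2 mul1r addrC; apply: expR_energy_threshold => //; rewrite /m; lia.
  by rewrite mulr0 !mul0r expR0 addr0.
have -> : 2 * p%:R ^+ 2 = \sum_(j < p) \sum_(k < p) (1 + (j == k)%:R * p%:R) :> R.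
  under eq_bigr => j _.
    rewrite big_split/= sumr_const card_ord (bigD1 j)//= big1 => [|k kj].
      rewrite eqxx mul1r addr0; over.
    by rewrite eq_sym (negbTE kj) mul0r.
  rewrite sumr_const card_ord -[RHS]mulr_natr; ring.
by apply: ler_sum => j _; apply: ler_sum => k _; exact: expTh.
Qed.
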